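(* Let $\mathbb{F}_q$ be a finite field of characteristic $p$, let $k=\mathbb{F}_q(T)$, and let $\overline{k}$ be an algebraic closure of $k$. Let $\mathcal{P}$ be the set of monic irreducible polynomials of $\mathbb{F}_q[T]$. For each $a\in\mathcal{P}\cup\{\frac{1}{T}\}$ and each $i\in\mathbb{N}\setminus p\mathbb{N}$, let $\theta_{a,i}\in\overline{k}$ be a root of the polynomial $X^p-X-a^{-i}$. Let $L\subset\overline{k}$ be the compositum of all the fields $k(\theta_{a,i})$ with $a\in\mathcal{P}\cup\{\frac{1}{T}\}$ and $i\in\mathbb{N}\setminus p\mathbb{N}$. Then $L$ is an abelian $p$-extension of $k$ whose local degrees are infinite above every place of $k$; that is, for every place $v$ of $k$ and every place $w$ of $L$ above $v$, one has $[L_w:k_v]=\infty$.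
   Context: The set $\mathcal{P}\cup\{\frac{1}{T}\}$ is in bijection with the set of places of $k$, an element $a$ corresponding to the valuation $v_a$ ($a$-adic valuation for $a\in\mathcal{P}$, and the valuation at infinity, with uniformizer $1/T$, for $a=\frac{1}{T}$). For a place $v$ of $k$, $k_v$ is the completion of $k$ at $v$. For an infinite algebraic extension $L/k$ and a place $w$ of $L$ above $v$, $L_w$ denotes the union of the completions at the restrictions of $w$ of the finite subextensions of $L/k$, and $[L_w:k_v]$ is the local degree. An abelian $p$-extension (possibly infinite) is a Galois extension whose Galois group is abelian and pro-$p$. *)

(* Defs.v *)
From HB Require Import structures.
From mathcomp Require Import all_boot all_order all_algebra separable.
From mathcomp Require Import all_classical all_reals.
From mathcomp Require Import topology exp.

Set Implicit Arguments.
Unset Strict Implicit.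
Unset Printing Implicit Defensive.

Import Order.TTheory GRing.Theory Num.Theory.

Local Open Scope classical_set_scope.
Local Open Scope ring_scope.

(* As an inverse of 0 is 0, closure under division needs no side condition. *)
Definition subfield (E : fieldType) (A : set E) : Prop :=
  divring_closed [pred x in A].

Section Adjoin.
Variables (K E : fieldType) (f : {rmorphism K -> E}) (S : set E).

Definition adjoin : set E := smallest (@subfield E) (range f `|` S).

Lemma adjoin_min (A : set E) :
  subfield A -> range f `<=` A -> S `<=` A -> adjoin `<=` A.
Proof.
by move=> sA fA SA; apply: smallest_sub => // x [/fA|/SA].
Qed.

Lemma sub_adjoin : S `<=` adjoin.
Proof. by move=> x Sx A [_]; apply; right. Qed.

Lemma range_adjoin (x : K) : adjoin (f x).
Proof. by move=> A [_]; apply; left; exists x. Qed.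

Definition adjoin_pred : {pred E} := [pred x in adjoin].

Lemma adjoin_subfield : divring_closed adjoin_pred.
Proof.
have mE (A : set E) (x : E) : (x \in [pred y in A]) = (x \in A) by [].
rewrite /adjoin_pred; split=> [|x y|x y]; rewrite !mE !in_setE.
- by move=> A [[+ _ _] _]; rewrite mE in_setE.
- move=> Sx Sy A AS; have [[_ + _] _] := AS => /(_ x y).
  by rewrite !mE !in_setE; apply; [exact: Sx|exact: Sy].
- move=> Sx Sy A AS; have [[_ _ +] _] := AS => /(_ x y).
  by rewrite !mE !in_setE; apply; [exact: Sx|exact: Sy].
Qed.

HB.instance Definition _ :=
  GRing.isDivringClosed.Build E adjoin_pred adjoin_subfield.

(* The field [adjoin], as a type. *)
Record adjoin_field := AdjoinField {
  adjoin_val : E;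
  adjoin_valP : adjoin_val \in adjoin_pred }.

HB.instance Definition _ := [isSub for adjoin_val].
HB.instance Definition _ := [Choice of adjoin_field by <:].
HB.instance Definition _ :=
  [SubChoice_isSubIntegralDomain of adjoin_field by <:].
HB.instance Definition _ :=
  [SubIntegralDomain_isSubField of adjoin_field by <:].

Lemma adjoin_embP (x : K) : f x \in adjoin_pred.
Proof. by apply: mem_set; exact: range_adjoin. Qed.

Definition adjoin_emb (x : K) : adjoin_field := AdjoinField (adjoin_embP x).

Lemma adjoin_emb_zmod_morphism : zmod_morphism adjoin_emb.
Proof. by move=> x y; apply: val_inj; rewrite /= rmorphB. Qed.

Lemma adjoin_emb_monoid_morphism : monoid_morphism adjoin_emb.
Proof.
by split=> [|x y]; apply: val_inj; rewrite /= ?rmorph1 ?rmorphM.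
Qed.

HB.instance Definition _ :=
  GRing.isZmodMorphism.Build K adjoin_field adjoin_emb adjoin_emb_zmod_morphism.
HB.instance Definition _ :=
  GRing.isMonoidMorphism.Build K adjoin_field adjoin_emb
    adjoin_emb_monoid_morphism.

End Adjoin.

#[short(type="groupTopologicalType")]
HB.structure Definition GroupTopological := {G of Group G & Topological G}.

Section ProP.
Variable G : groupTopologicalType.
Local Open Scope group_scope.

Definition topological_group : Prop :=
  continuous (fun xy : G * G => xy.1 * xy.2) /\ continuous (fun x : G => x^-1).

Definition profinite_group : Prop :=
  [/\ topological_group, compact [set: G], hausdorff_space G
    & totally_disconnected [set: G]].

Definition normal_subgroup (N : set G) : Prop :=
  group_closed [pred x in N] /\ forall x y, N x -> N (y^-1 * x * y).

Definition left_cosets (N : set G) : set (set G) :=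
  [set [set x * n | n in N] | x in [set: G]].

Definition pro_p_group (p : nat) : Prop :=
  profinite_group /\
  forall N : set G, open N -> normal_subgroup N ->
    exists n : nat, (left_cosets N #= `I_(p ^ n)%N)%card.

End ProP.

Section Galois.
Variables (K L : fieldType) (f : {rmorphism K -> L}).

Definition algebraic_ext : Prop := forall x : L, algebraicOver f x.

Definition normal_ext : Prop :=
  forall (q : {poly K}) (x : L), irreducible_poly q -> root (map_poly f q) x ->
    exists rs : seq L, map_poly f q %= \prod_(z <- rs) ('X - z%:P).

Definition separable_ext : Prop :=
  forall (q : {poly K}) (x : L), irreducible_poly q -> root (map_poly f q) x ->
    separable_poly q.

Definition galois_ext : Prop :=
  [/\ algebraic_ext, normal_ext & separable_ext].

Definition gal_axiom (g : L -> L) : Prop :=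
  [/\ zmod_morphism g, monoid_morphism g, bijective g & forall x, g (f x) = f x].

Record gal := Gal { gal_fun :> L -> L; gal_funP : gal_axiom gal_fun }.

Lemma gal_inj (g h : gal) : gal_fun g =1 gal_fun h -> g = h.
Proof.
case: g h => [g gP] [h hP] /= /funext gh.
by rewrite gh in gP *; congr Gal; exact: Prop_irrelevance.
Qed.

HB.instance Definition _ := gen_eqMixin gal.
HB.instance Definition _ := gen_choiceMixin gal.

Lemma gal_one_subproof : gal_axiom id.
Proof. by split=> //; exists id. Qed.

Lemma gal_mul_subproof (g h : gal) : gal_axiom (g \o h).
Proof.
case: g h => [g [gB [g1 gM] gbij gf]] [h [hB [h1 hM] hbij hf]] /=; split.
- by move=> x y /=; rewrite hB gB.
- by split=> [|x y] /=; rewrite ?h1 ?hM.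
- exact: bij_comp.
- by move=> x /=; rewrite hf.
Qed.

Lemma gal_inv_exists (g : gal) :
  exists h : gal, cancel (gal_fun g) h /\ cancel (gal_fun h) g.
Proof.
case: g => [g [gB [g1 gM] [h gK hK] gf]] /=.
suff hP : gal_axiom h by exists (Gal hP).
have gI := can_inj gK; split.
- by move=> x y; apply: gI; rewrite gB !hK.
- by split=> [|x y]; apply: gI; rewrite ?gM !hK.
- by exists g.
- by move=> x; apply: gI; rewrite hK gf.
Qed.

Definition gal_one : gal := Gal gal_one_subproof.
Definition gal_mul (g h : gal) : gal := Gal (gal_mul_subproof g h).
Definition gal_inv (g : gal) : gal := projT1 (cid (gal_inv_exists g)).

Lemma gal_mulA : associative gal_mul.
Proof. by move=> g h i; apply: gal_inj. Qed.
Lemma gal_mul1 : left_id gal_one gal_mul.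
Proof. by move=> g; apply: gal_inj. Qed.
Lemma gal_mulr1 : right_id gal_one gal_mul.
Proof. by move=> g; apply: gal_inj. Qed.
Lemma gal_mulV : left_inverse gal_one gal_inv gal_mul.
Proof.
by move=> g; apply: gal_inj; rewrite /gal_inv; case: cid => h [/= ].
Qed.
Lemma gal_mulrV : right_inverse gal_one gal_inv gal_mul.
Proof.
by move=> g; apply: gal_inj; rewrite /gal_inv; case: cid => h [/= ].
Qed.

HB.instance Definition _ :=
  isGroup.Build gal gal_mulA gal_mul1 gal_mulr1 gal_mulV gal_mulrV.

(* The Krull topology is the topology of pointwise convergence for the        *)
(* discrete topology on L: a basis of neighbourhoods of g is given by the     *)
(* sets of automorphisms that agree with g on a finite subset of L.           *)
HB.instance Definition _ := Topological.copy gal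
  (initial_topology (gal_fun : gal -> {ptws L -> discrete_topology L})).

Definition abelian_p_extension (p : nat) : Prop :=
  [/\ galois_ext, commutative (fun g h : gal => (g * h)%g) & pro_p_group gal p].

End Galois.

Section Places.
Variable R : realType.

Record absolute_value (K : fieldType) := AbsoluteValue {
  absv :> K -> R;
  absv_ge0 : forall x, 0 <= absv x;
  absv_eq0 : forall x, absv x = 0 <-> x = 0;
  absvM : forall x y, absv (x * y) = absv x * absv y;
  absvD : forall x y, absv (x + y) <= absv x + absv y }.

(* A place is an equivalence class of nontrivial absolute values, represented *)
(* below by any member of the class; v and v' are equivalent when v' = v ^ s  *)
(* for some s > 0, so that w lies above v when its restriction to K is        *)
(* equivalent to v. For K = F_q(T) the places are those of the a-adic         *)
(* valuations, for a monic irreducible, and of the valuation at infinity.     *)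
Definition nontrivial_av (K : fieldType) (v : absolute_value K) : Prop :=
  exists x : K, x != 0 /\ v x != 1.

Definition lies_above (K L : fieldType) (f : {rmorphism K -> L})
    (w : absolute_value L) (v : absolute_value K) : Prop :=
  exists2 s : R, 0 < s & forall x : K, w (f x) = v x `^ s.

Definition complete_av (M : fieldType) (v : absolute_value M) : Prop :=
  forall u : nat -> M,
    (forall e : R, 0 < e -> exists N : nat, forall m n : nat,
      (N <= m)%N -> (N <= n)%N -> v (u m - u n) < e) ->
    exists l : M, forall e : R, 0 < e -> exists N : nat, forall n : nat,
      (N <= n)%N -> v (u n - l) < e.

Definition av_closure (M : fieldType) (v : absolute_value M) (A : set M) :
    set M :=
  [set y | forall e : R, 0 < e -> exists2 x, A x & v (y - x) < e].

Record completion (L : fieldType) (w : absolute_value L) := Completion {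
  cpl_field :> fieldType;
  cpl_emb : {rmorphism L -> cpl_field};
  cpl_av : absolute_value cpl_field;
  cpl_isometry : forall x, cpl_av (cpl_emb x) = w x;
  cpl_complete : complete_av cpl_av;
  cpl_dense : av_closure cpl_av (range cpl_emb) = [set: cpl_field] }.

(* For A inside B, both subfields of M: B is a finite extension of A. *)
Definition finite_over (M : fieldType) (A B : set M) : Prop :=
  exists (n : nat) (e : 'I_n -> M), (forall i, B (e i)) /\
    forall y, B y -> exists2 c : 'I_n -> M,
      (forall i, A (c i)) & y = \sum_(i < n) c i * e i.

Section LocalDegree.
Variables (K L : fieldType) (f : {rmorphism K -> L}).
Variables (w : absolute_value L) (M : completion w).

Definition finite_subextension (E : set L) : Prop :=
  [/\ subfield E, range f `<=` E & finite_over (range f) E].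

(* The completion of a subfield E of L at the restriction of w, realized as   *)
(* the closure of E in a completion M of L at w. All these completions thus   *)
(* sit in the same field, which gives a meaning to their union.               *)
Definition local_completion (E : set L) : set M :=
  av_closure (cpl_av M) (cpl_emb M @` E).

Definition local_union : set M :=
  \bigcup_(E in finite_subextension) local_completion E.

End LocalDegree.
Arguments local_completion {L w} M E.
Arguments local_union {K L} f {w} M.

Definition local_degrees_infinite (K L : fieldType)
    (f : {rmorphism K -> L}) : Prop :=
  forall (v : absolute_value K) (w : absolute_value L),
    nontrivial_av v -> nontrivial_av w -> lies_above f w v ->
  forall M : completion w,
    ~ finite_over (local_completion M (range f)) (local_union f M).

End Places.
Arguments local_completion {R L w} M E.
Arguments local_union {R K L} f {w} M.

(* The monic irreducible polynomials of F[T], together with 1/T, in F(T). *)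
Definition place_elements (F : finFieldType) : set {fraction {poly F}} :=
  [set tofrac P | P in [set P : {poly F} | P \is monic /\ irreducible_poly P]]
  `|` [set (tofrac 'X)^-1].
Arguments place_elements : clear implicits.

Definition index_set (F : finFieldType) (p : nat) :
    set ({fraction {poly F}} * nat) :=
  [set ai | place_elements F ai.1 /\ ~~ (p %| ai.2)%N].
Arguments index_set : clear implicits.

(* Main.v *)
Require Import Defs.
From HB Require Import structures.
From mathcomp Require Import all_boot all_order all_algebra separable.
From mathcomp Require Import fingroup vector falgebra fieldext finfield.
From mathcomp Require Import all_classical all_reals.
From mathcomp Require Import topology exp.
From mathcomp Require galois.

Set Implicit Arguments.
Unset Strict Implicit.
Unset Printing Implicit Defensive.

Import Order.TTheory GRing.Theory Num.Theory.

Local Open Scope classical_set_scope.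
Local Open Scope ring_scope.

(** Write P(X) = X^p - X; it is additive in characteristic p, and the roots of
P(X) = a are t + c for one root t and c in the prime field.

L is an abelian p-extension. Every element of L lies in a subfield generated
by finitely many roots, which by the primitive element theorem is a simple
extension K(z).  All the polynomials P(X) - a that intervene are separable and
split as soon as they have a root, so K(z) is a splitting field of a product of
separable polynomials, and the theory of finite Galois extensions shows that
each element of L is a root of a polynomial over K with distinct roots in L
([AS_splitting], [AS_galois]).  An automorphism moves each generator by an
element of the prime field, which all automorphisms fix; hence they commute
([gal_AS_commutative]).  The Krull group is profinite because orbits are finite
([gal_profinite]), and an open subgroup contains the stabilizer of finitely
many generators, so the quotient is a section of some (Z/p)^r
([left_cosets_card], [gal_AS_pro_p]).

The local degrees are infinite.  Up to equivalence, w restricts to the absolute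
value of a place of F_q(T), and the values on K are the powers of |a| for the
element a attached to that place, with |a| < 1 ([place_uniformizer]).  The
same values occur on the completion A of K.  Take roots t_i of P(X) = a^-i with i prime to
p.  They are linearly independent over A ([AS_theta_independent]): normalize a
shortest relation sum c_i t_i = c_0 so that one coefficient is 1, and subtract
it from its p-th power.  This replaces c_i by P(c_i), which is shorter, so
P(c_i) = 0 for all i.  What remains is sum c_i a^-i = P(c_0) with coefficients
of absolute value 1 or 0.  On the left the absolute value is |a|^-i for the
largest i that occurs; on the right, being greater than 1, it is |c_0|^p, a
power of |a|^p.  This contradicts i being prime to p.  As infinitely many such
t_i lie in the union of the local completions, the latter has infinite degree
over A ([not_finite_over]). *)

(** * Subfields and simple extensions *)

Lemma subfieldP (E : fieldType) (A : set E) :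
  subfield A <->
  [/\ A 1, (forall x y, A x -> A y -> A (x - y))
    & (forall x y, A x -> A y -> A (x / y))].
Proof.
have mE (x : E) : (x \in [pred y in A]) = (x \in A) by [].
split=> [[A1 AB AV]|[A1 AB AV]].
- split=> [|x y Ax Ay|x y Ax Ay].
  + by move: A1; rewrite mE in_setE.
  + by move: (AB x y); rewrite !mE !in_setE; apply.
  + by move: (AV x y); rewrite !mE !in_setE; apply.
- split=> [|x y|x y]; rewrite !mE !in_setE //; [exact: AB|exact: AV].
Qed.

Lemma subfield_image (E E' : fieldType) (h : {rmorphism E -> E'}) (A : set E) :
  subfield A -> subfield (h @` A).
Proof.
move=> /subfieldP[A1 AB AV]; apply/subfieldP; split.
- by exists 1; rewrite ?rmorph1.
- by move=> _ _ [x Ax <-] [y Ay <-]; exists (x - y); rewrite ?rmorphB //; apply: AB.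
- by move=> _ _ [x Ax <-] [y Ay <-]; exists (x / y); rewrite ?fmorph_div //; apply: AV.
Qed.

Lemma adjoinP (K E : fieldType) (f : {rmorphism K -> E}) (S : set E) :
  subfield (adjoin f S).
Proof. exact: adjoin_subfield. Qed.

Lemma adjoinS (K E : fieldType) (f : {rmorphism K -> E}) (S T : set E) :
  S `<=` T -> adjoin f S `<=` adjoin f T.
Proof.
move=> ST; apply: adjoin_min; first exact: adjoinP.
- by move=> _ [y _ <-]; exact: range_adjoin.
- by move=> y /ST; exact: sub_adjoin.
Qed.

Lemma subfield_setT (E : fieldType) : subfield [set: E].
Proof. by apply/subfieldP. Qed.

Section SimpleExtension.
Variables (K L : fieldType) (f : {rmorphism K -> L}).

Definition poly_values (z : L) : set L := [set (map_poly f r).[z] | r in setT].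

Lemma poly_values_id z : poly_values z z.
Proof. by exists 'X; rewrite // map_polyX hornerX. Qed.

Lemma poly_values_base z x : poly_values z (f x).
Proof. by exists x%:P; rewrite // map_polyC hornerC. Qed.

(** Among the nonzero polynomials that vanish at z, one of least degree is
irreducible. *)
Lemma irreducible_root z : algebraicOver f z ->
  exists2 q : {poly K}, irreducible_poly q & root (map_poly f q) z.
Proof.
move=> [q0 q0_neq0 q0z].
pose P n := `[< exists q : {poly K}, [/\ q != 0, root (map_poly f q) z & size q = n] >].
have exP : exists n, P n by exists (size q0); apply/asboolP; exists q0.
case: (ex_minnP exP) => n /asboolP[q [q_neq0 qz szq]] nmin.
exists q => //; apply/(subfx_irreducibleP qz q_neq0) => r rz r_neq0.
by rewrite szq; apply: nmin; apply/asboolP; exists r.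
Qed.

(** The values at z of the polynomials over K are the image of the field
K[X]/(q), for an irreducible q that vanishes at z. *)
Lemma poly_values_subfield z : algebraicOver f z -> subfield (poly_values z).
Proof.
move=> /irreducible_root[q q_irr qz].
have -> : poly_values z = range (subfx_inj : subFExtend f z q -> L).
  have qn0 := irredp_neq0 q_irr.
  rewrite predeqE => y; split=> [[r _ <-]|[x _ <-]].
    by exists (subfx_eval f z q r); rewrite ?subfx_inj_eval.
  by have [r ->] := subfxE x; rewrite subfx_inj_eval //; exists r.
by apply: subfield_image; exact: subfield_setT.
Qed.

(** The powers of z below the degree of q span, by Euclidean division. *)
Lemma poly_values_finite z : algebraicOver f z ->
  finite_over (range f) (poly_values z).
Proof.
move=> [q q_neq0 qz]; exists (size q), (fun i => z ^+ i); split=> [i|_ [r _ <-]].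
  by exists 'X^i; rewrite // map_polyXn hornerXn.
exists (fun i => f (r %% q)`_i) => [i|]; first by exists (r %% q)`_i.
rewrite {1}(divp_eq r q) rmorphD rmorphM /= hornerD hornerM (rootP qz) mulr0 add0r.
rewrite (@horner_coef_wide _ (size q)) ?size_map_poly ?(ltnW (ltn_modpN0 _ _))//.
by apply: eq_bigr => i _; rewrite coef_map.
Qed.

Lemma finite_subextension_poly_values z : algebraicOver f z ->
  finite_subextension f (poly_values z).
Proof.
move=> zalg; split; [exact: poly_values_subfield| |exact: poly_values_finite].
by move=> _ [x _ <-]; exact: poly_values_base.
Qed.

Definition infinite_field : Prop :=
  forall n, exists s : seq K, uniq s /\ (size s = n)%N.

(** Induction on s: if z is primitive for the tail, then for all but finitely
many c in K both t and z are polynomials in c t - z. *)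
Lemma primitive_element (s : seq L) : infinite_field ->
  (forall t, t \in s ->
    exists2 q : {poly K}, separable_poly q & root (map_poly f q) t) ->
  exists z, [/\ adjoin f [set` s] z, algebraicOver f z
              & forall t, t \in s -> poly_values z t].
Proof.
move=> Kinf; elim: s => [_|t s IHs sepS].
  exists 0; split=> //; last exact: algebraic0.
  by rewrite -(rmorph0 f); exact: range_adjoin.
have [|z [zs [q q_neq0 qz] sz]] := IHs.
  by move=> u us; apply: sepS; rewrite inE us orbT.
have [|r sep_r rt] := sepS t; first by rewrite inE eqxx.
have [c c_neq0 cP] := large_field_PET q_neq0 qz rt sep_r.
have [l [ul szl]] := Kinf (size c).
have : ~~ all (root c) (map f l).
  apply/negP => /max_poly_roots => /(_ c_neq0).
  by rewrite map_inj_uniq ?ul ?size_map ?szl ?ltnn; [move/(_ isT)|exact: fmorph_inj].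
rewrite all_map => /allPn[a _ /= /cP[wz wt]].
pose w := f a * t - z; exists w.
have walg : algebraicOver f w.
  apply: algebraic_sub; last by exists q.
  apply: algebraic_mul; first exact: algebraic_id.
  by exists r => //; exact: separable_poly_neq0.
have sub0 := poly_values_subfield walg.
have toset v : (exists q0, (map_poly f q0).[w] = v) -> poly_values w v.
  by move=> [q0 <-]; exists q0.
split=> //.
- have /subfieldP[A1 AB AV] := adjoinP f [set` t :: s].
  have At : adjoin f [set` t :: s] t by apply: sub_adjoin; rewrite /= inE eqxx.
  apply: AB; last first.
    by apply: adjoinS zs => u us; rewrite /= inE us orbT.
  rewrite -[t in _ * t]invrK; apply: (AV) => //; first exact: range_adjoin.
  by rewrite -div1r; apply: AV.
- move=> u; rewrite inE => /orP[/eqP ->|/sz[v _ <-]]; first exact: toset.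
  have [k kE] := wz; exists (v \Po k) => //.
  by rewrite map_comp_poly horner_comp kE.
Qed.

End SimpleExtension.

(** * Artin-Schreier polynomials *)

Section ArtinSchreierPolynomial.
Variables (p : nat) (K : fieldType).
Hypothesis pcharK : p \in [pchar K].

Definition ASpoly (a : K) : {poly K} := 'X^p - 'X - a%:P.

Lemma pchar_natr_inj : {in gtn p &, injective (fun i => i%:R : K)}.
Proof.
move=> i j ip jp; wlog ij : i j ip jp / (i <= j)%N => [H eij|/= eij].
  have [ij|/ltnW ji] := leqP i j; first exact: H.
  exact/esym/H.
have : (p %| j - i)%N by rewrite (dvdn_pcharf pcharK) natrB // eij subrr.
rewrite /dvdn modn_small ?(leq_ltn_trans (leq_subr _ _)) // subn_eq0 => ji.
by apply/eqP; rewrite eqn_leq ij.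
Qed.

Lemma pchar_expD (x y : K) : (x + y) ^+ p = x ^+ p + y ^+ p.
Proof. by rewrite -[LHS]/(pFrobenius_aut pcharK _) rmorphD. Qed.

Lemma pchar_expB (x y : K) : (x - y) ^+ p = x ^+ p - y ^+ p.
Proof. by rewrite -[LHS]/(pFrobenius_aut pcharK _) rmorphB. Qed.

Lemma pchar_natrX n : (n%:R : K) ^+ p = n%:R.
Proof. by rewrite -[LHS]/(pFrobenius_aut pcharK _) rmorph_nat. Qed.

(** The derivative is the constant -1. *)
Lemma separable_ASpoly a : separable_poly (ASpoly a).
Proof.
rewrite unlock /ASpoly !derivB derivXn derivX derivC subr0.
rewrite -mulr_natl -[p%:R]polyC_natr (pcharf0 pcharK) polyC0 mul0r sub0r.
by rewrite -[- 1]scaleN1r coprimepZr ?oppr_eq0 ?oner_eq0 // coprimep1.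
Qed.

Lemma size_ASpoly a : size (ASpoly a) = p.+1.
Proof.
have p1 : (1 < p)%N := prime_gt1 (pcharf_prime pcharK).
rewrite /ASpoly -addrA size_polyDl ?size_polyXn // -opprD size_polyN.
by rewrite size_XaddC ltnS.
Qed.

Lemma ASpoly_prod (t : K) :
  ASpoly (t ^+ p - t) = \prod_(r <- [seq t + i%:R | i <- iota 0 p]) ('X - r%:P).
Proof.
set rs := map _ _.
have rs_uniq : uniq rs.
  rewrite map_inj_in_uniq ?iota_uniq // => i j.
  rewrite !mem_iota !add0n => ip jp /addrI; exact: pchar_natr_inj.
have -> : ASpoly (t ^+ p - t) =
    lead_coef (ASpoly (t ^+ p - t)) *: \prod_(r <- rs) ('X - r%:P).
  apply: all_roots_prod_XsubC.
  - by rewrite size_ASpoly size_map size_iota.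
  - apply/allP => _ /mapP[i _ ->]; rewrite rootE /ASpoly !hornerE.
    rewrite pchar_expD pchar_natrX opprD addrACA subrr addr0 subrr.
    by [].
  - by rewrite uniq_rootsE.
suff -> : lead_coef (ASpoly (t ^+ p - t)) = 1 by rewrite scale1r.
have p1 : (1 < p)%N := prime_gt1 (pcharf_prime pcharK).
rewrite lead_coefE size_ASpoly /= /ASpoly !coefB coefXn coefX coefC.
by rewrite (eqxx p) !gtn_eqF ?(ltnW p1) //= !subr0.
Qed.

(** The case t = 0 of the factorization: X^p - X has no roots outside the prime
field. *)
Lemma pchar_exp_fix (c : K) : c ^+ p = c -> exists n : nat, c = n%:R.
Proof.
move=> cp; have /esym := ASpoly_prod 0; have p1 := prime_gt0 (pcharf_prime pcharK).
rewrite expr0n gtn_eqF // subr0 => /(congr1 (fun q => root q c)).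
rewrite root_prod_XsubC [root _ _]rootE /ASpoly !hornerE cp subrr subr0 eqxx.
by move=> /mapP[i _ ->]; exists i; rewrite add0r.
Qed.

End ArtinSchreierPolynomial.

(** * Extensions generated by Artin-Schreier roots are Galois *)

Section ArtinSchreierExtension.
Import galois.
Variables (p : nat) (K L : fieldType) (f : {rmorphism K -> L}) (S : set L).
Hypotheses (pcharK : p \in [pchar K]) (Kinf : infinite_field K).
Hypotheses (AS_S : forall t, S t -> exists a, t ^+ p - t = f a)
  (S_gen : adjoin f S = [set: L]).

Lemma root_ASpoly (t : L) a :
  root (map_poly f (ASpoly p a)) t <-> t ^+ p - t = f a.
Proof.
rewrite /ASpoly !rmorphB /= map_polyXn map_polyX map_polyC /= rootE !hornerE.
by rewrite subr_eq0; split=> /eqP.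
Qed.

Lemma ASpoly_neq0 (a : K) : ASpoly p a != 0.
Proof. exact/separable_poly_neq0/separable_ASpoly. Qed.

Lemma AS_algebraic : algebraic_ext f.
Proof.
have sub : subfield [set x | algebraicOver f x].
  by apply/subfieldP; split; [exact: algebraic1|exact: algebraic_sub|exact: algebraic_div].
suff alg : adjoin f S `<=` [set x | algebraicOver f x].
  by move=> x; apply: alg; rewrite S_gen.
apply: adjoin_min => // [_ [x _ <-]|t /AS_S[a /root_ASpoly ta]]; first exact: algebraic_id.
by exists (ASpoly p a) => //; exact: ASpoly_neq0.
Qed.

Lemma finitely_generated x :
  exists2 s : seq L, [set` s] `<=` S & adjoin f [set` s] x.
Proof.
pose A := [set x | exists2 s : seq L, [set` s] `<=` S & adjoin f [set` s] x].
suff AT : adjoin f S `<=` A by have := AT x; rewrite S_gen; exact.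
have join y z : A y -> A z -> exists2 s : seq L, [set` s] `<=` S &
    adjoin f [set` s] y /\ adjoin f [set` s] z.
  move=> [s sS sy] [s' sS' sz]; exists (s ++ s').
    by move=> t /=; rewrite mem_cat => /orP[/sS|/sS'].
  by split; [move: y sy|move: z sz]; apply: adjoinS => t /=; rewrite mem_cat => ->; rewrite ?orbT.
apply: adjoin_min.
- apply/subfieldP; split=> [|y z Ay Az|y z Ay Az].
  + by exists [::] => //; rewrite -(rmorph1 f); exact: range_adjoin.
  + have [s sS [sy sz]] := join _ _ Ay Az; exists s => //.
    by have /subfieldP[_ + _] := adjoinP f [set` s]; apply.
  + have [s sS [sy sz]] := join _ _ Ay Az; exists s => //.
    by have /subfieldP[_ _ +] := adjoinP f [set` s]; apply.
- by move=> _ [y _ <-]; exists [::] => //; exact: range_adjoin.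
- move=> t St; exists [:: t]; first by move=> u /=; rewrite inE => /eqP ->.
  by apply: sub_adjoin => /=; rewrite inE.
Qed.

(** The element x lies in a simple extension E = K(z) generated by finitely many
of the given roots.  E is a splitting field of a product of Artin-Schreier
polynomials, hence is Galois over K, and q is the minimal polynomial of x. *)
Lemma AS_splitting x : exists (q : {poly K}) (rs : seq L),
  [/\ map_poly f q = \prod_(r <- rs) ('X - r%:P), uniq rs & x \in rs].
Proof.
have [s sS sx] := finitely_generated x.
have [|z [sz zalg zs]] := primitive_element (f := f) (s := s) Kinf.
  move=> t /sS /AS_S[a /root_ASpoly ta]; exists (ASpoly p a) => //.
  exact: separable_ASpoly.
have [q q_irr qz] := irreducible_root zalg.
pose E := SubFieldExtType qz q_irr.
pose j : {rmorphism E -> L} := subfx_inj : {rmorphism subFExtend f z q -> L}.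
have q_neq0 := irredp_neq0 q_irr.
have jf a : j a%:A = f a by exact: subfx_inj_base.
(* The roots s that generate, seen in E. *)
have [ts tsE] : exists ts : seq E, map j ts = s.
  elim: (s) zs => [|t s' IHs] zs; first by exists [::].
  have [u us|ts <-] := IHs; first by apply: zs; rewrite inE us orbT.
  have [r _ rt] := zs t (mem_head _ _); exists (subfx_eval f z q r :: ts) => /=.
  by rewrite [X in X :: _](subfx_inj_eval qz q_neq0) rt.
have pcharE : p \in [pchar E] by rewrite (fmorph_pchar (in_alg E)).
have AS_ts t : t \in ts -> exists a : K, t ^+ p - t = a%:A.
  move=> tts; have [|a ta] := AS_S (t := j t).
    by apply: sS => /=; rewrite -tsE map_f.
  by exists a; apply: (fmorph_inj j); rewrite rmorphB rmorphXn ta jf.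
have ts_gen : <<1 & ts>>%VS = {:E}%VS.
  apply/vspaceP => y; rewrite memvf.
  have jtsP : subfield (j @` [set y | y \in <<1 & ts>>%VS]).
    apply: subfield_image; apply/subfieldP; split=> [|u v|u v] /=.
    - exact: rpred1.
    - exact: rpredB.
    - exact: rpred_div.
  have adj_sub : adjoin f [set` s] `<=` j @` [set y | y \in <<1 & ts>>%VS].
    apply: adjoin_min => // [_ [a _ <-]|t /=].
      by exists (a%:A); [apply: memvZ; exact: rpred1|exact: jf].
    rewrite -tsE => /mapP[u us ->]; exists u => //=.
    exact: seqv_sub_adjoin.
  have [w wts jw] := adj_sub _ sz.
  have [r ->] := subfxEroot qz q_neq0 y.
  have -> : subfx_root f z q = w :> E.
    by apply: (fmorph_inj j); rewrite jw [LHS]subfx_inj_root.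
  rewrite rpred_horner //.
  by apply/polyOverP => i; rewrite coef_map; apply: memvZ; exact: rpred1.
(* A root t may occur several times in ts, so P need not be separable:
   normality comes from P and separability from the generators. *)
pose P : {poly E} := \prod_(t <- ts) ASpoly p (t ^+ p - t).
have P1 : P \is a polyOver 1%VS.
  rewrite /P big_seq; apply: rpred_prod => t /AS_ts[a ->].
  rewrite /ASpoly !rpredB ?polyOverXn ?polyOverX // polyOverC.
  by apply: memvZ; exact: rpred1.
have Psplit : splittingFieldFor 1 P {:E}.
  exists (flatten [seq [seq t + i%:R | i <- iota 0 p] | t <- ts]).
    rewrite big_flatten big_map /P (eq_bigr _ (fun t _ => ASpoly_prod pcharE t)).
    exact: eqpxx.
  apply/eqP; rewrite eqEsubv subvf /= -ts_gen.
  apply/Fadjoin_seqP; split; first exact: subv_adjoin_seq.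
  move=> t tts; apply: seqv_sub_adjoin; apply/flatten_mapP; exists t => //.
  apply/mapP; exists 0; rewrite ?addr0 // mem_iota /= add0n.
  exact: prime_gt0 (pcharf_prime pcharK).
pose E' : splittingFieldType K :=
  HB.pack E (FieldExt_isSplittingField.Build K E (ex_intro2 _ _ P P1 Psplit)).
have galE : galois 1%AS {:E'}%AS.
  rewrite /galois sub1v /=; apply/andP; split; last first.
    by apply/splitting_normalField; [exact: sub1v|exists P].
  have <- : <<1 & (ts : seq E')>>%VS = {:E'}%VS by exact: ts_gen.
  apply/separable_Fadjoin_seq/allP => t /AS_ts[a ta].
  apply: (dvdp_separable _ (separable_ASpoly pcharE (a%:A))).
  apply: minPoly_dvdp.
    rewrite /ASpoly !rpredB ?polyOverXn ?polyOverX // polyOverC.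
    by apply: memvZ; exact: rpred1.
  by rewrite rootE /ASpoly !hornerE ta subrr.
have [y jy] : exists y, j y = x.
  have : adjoin f [set` s] `<=` range j.
    apply: adjoin_min.
    - by apply: subfield_image; exact: subfield_setT.
    - by move=> _ [a _ <-]; exists a%:A.
    - by move=> t /=; rewrite -tsE => /mapP[u _ ->]; exists u.
  by move=> /(_ _ sx)[y _ <-]; exists y.
have /(galois_factors (sub1v _))/(_ y (memvf _))[r [_ rU rE]] := galE.
have /polyOver1P[m mE] := minPolyOver 1 (y : E').
set ra := [seq _ | _ <- r] in rU rE.
exists m, (map j ra); split.
- have -> : map_poly f m = map_poly j (map_poly (in_alg E) m).
    by rewrite -map_poly_comp; apply: eq_map_poly => a /=; rewrite jf.
  rewrite big_map -[map_poly (in_alg E) m]mE rE rmorph_prod.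
  by apply: eq_bigr => u _ /=; rewrite rmorphB /= map_polyX map_polyC.
- by rewrite map_inj_uniq //; exact: fmorph_inj.
- by rewrite -jy map_f // -root_prod_XsubC -rE root_minPoly.
Qed.

(** An irreducible q with a root x shares this root with the polynomial m that
[AS_splitting] gives for x, so q divides m and inherits that m is split with
distinct roots. *)
Lemma AS_galois : galois_ext f.
Proof.
have key (q : {poly K}) x : irreducible_poly q -> root (map_poly f q) x ->
    exists (m : {poly K}) (rs : seq L),
    [/\ q %| m, map_poly f m = \prod_(r <- rs) ('X - r%:P) & uniq rs].
  move=> q_irr qx; have [m [rs [mE rsU xrs]]] := AS_splitting x.
  exists m, rs; split => //.
  have : ~~ coprimep q m.
    rewrite -(coprimep_map f); apply/negP => /coprimep_root /(_ qx).
    by rewrite mE -rootE root_prod_XsubC xrs.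
  rewrite coprimep_def => H.
  have /eqp_dvdl <- : gcdp q m %= q by apply: q_irr.2 => //; exact: dvdp_gcdl.
  exact: dvdp_gcdr.
split.
- exact: AS_algebraic.
- move=> q x q_irr /(key _ _ q_irr)[m [rs [qm mE _]]].
  have := qm; rewrite -(dvdp_map f) mE => /dvdp_prod_XsubC[b Hb].
  by exists (mask b rs).
- move=> q x q_irr /(key _ _ q_irr)[m [rs [qm mE rsU]]].
  apply: dvdp_separable qm _.
  by rewrite -(separable_map f) mE separable_prod_XsubC.
Qed.

End ArtinSchreierExtension.

(** * The Krull topology *)

Section GaloisGroup.
Variables (K L : fieldType) (f : {rmorphism K -> L}).

Lemma gal_zmod_morphism (g : gal f) : zmod_morphism g.
Proof. by case: g => ? []. Qed.
Lemma gal_monoid_morphism (g : gal f) : monoid_morphism g.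
Proof. by case: g => ? []. Qed.

HB.instance Definition _ (g : gal f) :=
  GRing.isZmodMorphism.Build L L (gal_fun g) (gal_zmod_morphism g).
HB.instance Definition _ (g : gal f) :=
  GRing.isMonoidMorphism.Build L L (gal_fun g) (gal_monoid_morphism g).

Lemma gal_base (g : gal f) x : g (f x) = f x.
Proof. by case: g => ? []. Qed.
Lemma galMgE (g h : gal f) x : (g * h)%g x = g (h x).
Proof. by []. Qed.
Lemma gal1gE x : (1%g : gal f) x = x.
Proof. by []. Qed.
Lemma galKV (g : gal f) x : g ((g^-1)%g x) = x.
Proof. by rewrite -galMgE mulgV. Qed.
Lemma galK (g : gal f) x : (g^-1)%g (g x) = x.
Proof. by rewrite -galMgE mulVg. Qed.

Lemma gal_open (x y : L) : open [set g : gal f | g x = y].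
Proof.
exists [set u : {ptws L -> discrete_topology L} | u x = y] => //.
pose T : topologicalType := discrete_topology L.
have Ty : open ([set y] : set T) by exact: discrete_open.
pose ev : {ptws L -> T} -> T := @proj L (fun=> T) x.
suff : open (ev @^-1` [set y]) by [].
by apply: open_comp => // u _; exact: proj_continuous.
Qed.

Definition agree_on (s : seq L) (g : gal f) : set (gal f) :=
  [set h | forall x, x \in s -> h x = g x].

Lemma agree_on_nbhs (s : seq L) (g : gal f) : nbhs g (agree_on s g).
Proof.
elim: s => [|x s IHs]; first by apply: filterS filterT => h _ x.
apply: filterS2 IHs (open_nbhs_nbhs (conj (gal_open x (g x)) erefl)) => h hs hx y.
by rewrite inE => /orP[/eqP ->|/hs].
Qed.

(** The sets of automorphisms that agree with g on a finite set generate a filter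
that converges to g pointwise, hence in the Krull topology. *)
Lemma gal_nbhsP (g : gal f) (B : set (gal f)) :
  nbhs g B <-> exists s, agree_on s g `<=` B.
Proof.
split=> [|[s sB]]; last by apply: filterS sB _; exact: agree_on_nbhs.
pose F := filter_from [set: seq L] (fun s => agree_on s g).
have FF : Filter F.
  apply: filter_from_filter; first by exists [::].
  move=> s s' _ _; exists (s ++ s') => // h hss'.
  by split=> x xs; apply: hss'; rewrite mem_cat xs ?orbT.
have Feval x : F [set h | h x = g x].
  by exists [:: x] => // h; apply; rewrite inE.
suff Fg : F --> g by move=> /Fg[s _ sB]; exists s.
have Fg : @gal_fun K L f @ F --> (gal_fun g : {ptws L -> discrete_topology L}).
  apply/cvg_sup => x A [_ [[C _ <-]] /= Cgx CA].
  by apply: filterS (Feval x) => h hx; apply: CA; rewrite /= hx.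
move=> A [_ [[C C_open <-]] Cg CA].
by apply: filterS CA _; apply: Fg; exact: open_nbhs_nbhs.
Qed.

Lemma gal_topological_group : topological_group (gal f).
Proof.
split=> [[g h] B|g B] /= /gal_nbhsP[s sB].
- pose U := [set gh : gal f * gal f |
             agree_on (map h s) g gh.1 /\ agree_on s h gh.2].
  have : nbhs (g, h) U.
    by exists (agree_on (map h s) g, agree_on s h) => //; split; exact: agree_on_nbhs.
  apply: filterS => -[g' h'] [/= g'P h'P]; apply: sB => x xs.
  by rewrite !galMgE h'P // g'P // map_f.
- have : nbhs g (agree_on (map (g^-1)%g s) g) by exact: agree_on_nbhs.
  apply: filterS => h hP; apply: sB => x xs.
  by rewrite -{1}(galKV g x) -hP ?map_f // galK.
Qed.

Lemma gal_hausdorff : hausdorff_space (gal f).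
Proof.
move=> g h gh; apply: gal_inj => x.
have [k [/= kg kh]] := gh _ _ (agree_on_nbhs [:: x] g) (agree_on_nbhs [:: x] h).
by rewrite -(kg x) ?inE // (kh x) ?inE.
Qed.

Lemma gal_totally_disconnected : totally_disconnected [set: gal f].
Proof.
apply: zero_dimension_totally_disconnected => g h /eqP gh.
have [x gxhx] : exists x, g x <> h x.
  by apply: contrapT => /forallNP H; apply/gh/gal_inj => x; exact: contrapT (H x).
exists [set k : gal f | k x = g x]; split=> //; last exact: nesym.
split; first exact: gal_open.
rewrite -[X in closed X]setCK; apply: open_closedC.
have -> : ~` [set k : gal f | k x = g x] =
    \bigcup_(y in [set y | y <> g x]) [set k : gal f | k x = y].
  rewrite predeqE => k; split=> [kx|[y yx /= kx]]; [by exists (k x)|by rewrite /= kx].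
by apply: bigcup_open => y _; exact: gal_open.
Qed.

Hypothesis algf : algebraic_ext f.

(** Automorphisms permute the roots of a polynomial over K that vanishes at x. *)
Lemma gal_orbit_finite (x : L) : exists s : seq L, forall g : gal f, g x \in s.
Proof.
have [q q_neq0 qx] := algf x.
have fq_neq0 : map_poly f q != 0 by rewrite map_poly_eq0.
suff [s sP] : exists s : seq L, forall y, root (map_poly f q) y -> y \in s.
  exists s => g; apply: sP.
  have -> : map_poly f q = map_poly g (map_poly f q).
    by rewrite -map_poly_comp; apply: eq_map_poly => a /=; rewrite gal_base.
  by rewrite rootE horner_map (rootP qx) rmorph0.
move: fq_neq0; move: (map_poly f q) => {qx q_neq0} {}q.
have [n szq] := ubnP (size q); elim: n => // n IHn in q szq * => q_neq0.
have [[y qy]|noroot] := pselect (exists y, root q y); last first.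
  by exists [::] => y qy; case: noroot; exists y.
have /factor_theorem[r rE] := qy.
have r_neq0 : r != 0 by apply: contraNneq q_neq0 => r0; rewrite rE r0 mul0r.
have [|//|s sP] := IHn r.
  by rewrite -ltnS (leq_trans _ szq) // rE size_Mmonic ?monicXsubC // size_XsubC addn2.
exists (y :: s) => z; rewrite rE rootM root_XsubC inE => /orP[/sP ->|->//].
by rewrite orbT.
Qed.

Lemma ultra_finite (T : Type) (Y : eqType) (U : set_system T) (h : T -> Y)
    (s : seq Y) :
  UltraFilter U -> (forall g, h g \in s) -> exists y, U [set g | h g = y].
Proof.
move=> UU hs; apply: contrapT => /forallNP noy.
have UC (s' : seq Y) : U [set g | forall y, y \in s' -> h g <> y].
  elim: s' => [|y s' IHs]; first by apply: filterS filterT => g _ y.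
  have [/noy//|Uy] := in_ultra_setVsetC [set g | h g = y] UU.
  apply: filterS2 IHs Uy => g gs gy z.
  by rewrite inE => /orP[/eqP -> //|/gs].
have [g /(_ _ (hs g))] := filter_ex (UC s); exact.
Qed.

(** An ultrafilter on the group stabilizes at each x, since x has finitely many
images; the limit values define the automorphism to which it converges.
Surjectivity comes from stabilizing the inverses in the same way. *)
Lemma gal_compact : compact [set: gal f].
Proof.
rewrite compact_ultra => U UU _.
have /choice[h hP] x : exists y, U [set g : gal f | g x = y].
  by have [s /ultra_finite] := gal_orbit_finite x; apply.
have hV y : exists x, U [set g : gal f | (g^-1)%g y = x].
  have [s sP] := gal_orbit_finite y.
  by apply: (@ultra_finite _ _ U (fun g : gal f => (g^-1)%g y) s) => // g; exact: sP.
(* Each identity involves finitely many values of h, and a single automorphism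
   takes all of them. *)
have h_axiom : gal_axiom f h.
  split.
  - move=> x y; have [g [[/= <- <-] <-]] :=
      filter_ex (filterI (filterI (hP x) (hP y)) (hP (x - y))).
    exact: rmorphB.
  - split=> [|x y]; first by have [g <-] := filter_ex (hP 1); exact: rmorph1.
    have [g [[/= <- <-] <-]] :=
      filter_ex (filterI (filterI (hP x) (hP y)) (hP (x * y))).
    exact: rmorphM.
  - have /choice[k kP] := hV; exists k => x.
      have [g [/= hx kx]] := filter_ex (filterI (hP x) (kP (h x))).
      by rewrite -kx -hx galK.
    have [g [/= kx hx]] := filter_ex (filterI (kP x) (hP (k x))).
    by rewrite -hx -kx galKV.
  - by move=> x; have [g <-] := filter_ex (hP (f x)); exact: gal_base.
exists (Gal h_axiom); split=> // B /gal_nbhsP[s sB].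
apply: filterS sB _; elim: s => [|x s IHs]; first by apply: filterS filterT => g _ x.
apply: filterS2 IHs (hP x) => g gs gx y.
by rewrite inE => /orP[/eqP ->|/gs].
Qed.

Lemma gal_profinite : profinite_group (gal f).
Proof.
split; [exact: gal_topological_group|exact: gal_compact|exact: gal_hausdorff|].
exact: gal_totally_disconnected.
Qed.

Lemma gal_eq_gen (S : set L) (g h : gal f) : adjoin f S = [set: L] ->
  (forall t, S t -> g t = h t) -> g = h.
Proof.
move=> S_gen gh; apply: gal_inj => x.
suff : adjoin f S `<=` [set x | g x = h x] by apply; rewrite S_gen.
apply: adjoin_min => // [|_ [a _ <-]]; last by rewrite /= !gal_base.
apply/subfieldP; split=> [|y z /= gy gz|y z /= gy gz]; first by rewrite /= !rmorph1.
- by rewrite !rmorphB /= gy gz.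
- rewrite !fmorph_div /=.
  by rewrite gy gz.
Qed.

End GaloisGroup.

(** * The Galois group is abelian and pro-p *)

Section ArtinSchreierGaloisGroup.
Variables (p : nat) (K L : fieldType) (f : {rmorphism K -> L}) (S : set L).
Hypothesis (pcharK : p \in [pchar K]).
Hypotheses (AS_S : forall t, S t -> exists a, t ^+ p - t = f a)
  (S_gen : adjoin f S = [set: L]).

Let pcharL : p \in [pchar L]. Proof. by rewrite (fmorph_pchar f). Qed.

Lemma gal_nat (g : gal f) (n : nat) : g n%:R = n%:R.
Proof. by rewrite -(rmorph_nat f) gal_base. Qed.

(** If t^p - t is in K then g t - t is fixed by the Frobenius. *)
Lemma gal_AS (g : gal f) t : S t -> exists n : nat, g t = t + n%:R.
Proof.
move=> St; have [a ta] := AS_S St.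
have [n nE] : exists n : nat, g t - t = n%:R.
  apply: (pchar_exp_fix pcharL); rewrite (pchar_expB pcharL).
  have gtp : g t ^+ p = g (t ^+ p) by rewrite rmorphXn.
  have tp : t ^+ p = t + f a by rewrite -ta addrC subrK.
  rewrite gtp tp rmorphD /= gal_base.
  by rewrite opprD addrACA subrr addr0.
by exists n; rewrite -nE addrC subrK.
Qed.

Lemma gal_AS_commutative : commutative (fun g h : gal f => (g * h)%g).
Proof.
move=> g h; apply: (gal_eq_gen S_gen) => t St; rewrite !galMgE.
have [n gt] := gal_AS g St; have [m ht] := gal_AS h St.
rewrite ht rmorphD /= gal_nat gt.
by rewrite rmorphD /= gal_nat ht addrAC.
Qed.

End ArtinSchreierGaloisGroup.

Lemma card_eq_finset (T : finType) (A : {set T}) : ([set` A] #= `I_#|A|)%card.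
Proof.
have -> : `I_#|A| = (fun x => index x (enum A)) @` [set` A].
  rewrite predeqE => i; split=> [/= iA|[x /= xA <-]]; last first.
    by rewrite cardE index_mem mem_enum.
  have [x0 _] : exists x0, x0 \in A by apply/card_gt0P; exact: leq_ltn_trans iA.
  have {}iA : (i < size (enum A))%N by rewrite -cardE.
  exists (nth x0 (enum A) i); last by rewrite index_uniq ?enum_uniq.
  by rewrite /= -mem_enum mem_nth.
rewrite card_eq_sym; apply: inj_card_eq => x y; rewrite !in_setE /= => xA yA.
by apply: (@index_inj _ x); rewrite mem_enum.
Qed.

(** If a subgroup N contains the kernel of a morphism chi to a finite group V, its
cosets correspond to those of chi(N) in chi(G); their number is the index of a
subgroup of a subgroup of V. *)
Lemma left_cosets_card (G : groupTopologicalType) (N : set G) (V : finGroupType)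
    (chi : G -> V) :
  {morph chi : g h / (g * h)%g} -> (forall g, chi g = 1%g -> N g) ->
  group_closed [pred g in N] ->
  exists2 n : nat, (n %| #|[set: V]%SET|)%N & (left_cosets N #= `I_n)%card.
Proof.
move=> chiM chiN [N1 NV].
have {}N1 : N 1%g by move: N1; rewrite /= in_setE.
have {}NV g h : N g -> N h -> N (g / h)%g.
  by move: (NV g h); rewrite /= !unfold_in !in_setE; apply.
have NI g : N g -> N (g^-1)%g by move=> Ng; rewrite -[_^-1%g]div1g; exact: NV.
have NM g h : N g -> N h -> N (g * h)%g.
  by move=> Ng Nh; rewrite -[h]invgK; apply: NV => //; exact: NI.
have chi1 : chi 1%g = 1%g by apply: (mulgI (chi 1%g)); rewrite -chiM !mulg1.
have chiV g : chi (g^-1)%g = ((chi g)^-1)%g.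
  by apply: (mulgI (chi g)); rewrite -chiM !mulgV.
have chiNE g h : chi g = chi h -> N g -> N h.
  move=> gh Ng; rewrite -[h](mulKVg g); apply: NM => //; apply: chiN.
  by rewrite chiM chiV gh mulVg.
pose M := [set v : V | `[< exists2 g, N g & chi g = v >]]%SET.
pose W := [set v : V | `[< exists g, chi g = v >]]%SET.
have ME v : v \in M <-> exists2 g, N g & chi g = v.
  by rewrite /M finset.inE; split=> /asboolP.
have WE v : v \in W <-> exists g, chi g = v.
  by rewrite /W finset.inE; split=> /asboolP.
have M_group : group_set M.
  apply/group_setP; split=> [|u v /ME[g Ng <-] /ME[h Nh <-]].
    by apply/ME; exists 1%g.
  by apply/ME; exists (g * h)%g; [exact: NM|exact: chiM].
have W_group : group_set W.
  apply/group_setP; split=> [|u v /WE[g <-] /WE[h <-]].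
    by apply/WE; exists 1%g.
  by apply/WE; exists (g * h)%g; exact: chiM.
pose MG := group M_group; pose WG := group W_group.
have inM g : (chi g \in M) <-> N g.
  split=> [/ME[h Nh hg]|Ng]; last by apply/ME; exists g.
  exact: chiNE hg Nh.
(* Taking preimages under chi sends the cosets of M in W to those of N. *)
pose Phi (C : {set V}) : set G := [set g | chi g \in C].
have PhiE g : Phi (chi g *: M)%g = [set (g * n)%g | n in N].
  rewrite predeqE => h; split=> [/=|[n Nn <-] /=].
    rewrite /Phi /= mem_lcoset -chiV -chiM => /inM Ngh.
    by exists (g^-1 * h)%g => //; rewrite mulKVg.
  by rewrite /Phi /= mem_lcoset -chiV -chiM mulKg; apply/inM.
exists #|lcosets M W|.
  rewrite -[lcosets M W]/(lcosets MG WG) card_lcosets.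
  have WV : WG \subset [set: V]%G by exact: finset.subsetT.
  exact: dvdn_trans (dvdn_indexg _ _) (cardSg WV).
have -> : left_cosets N = Phi @` [set` lcosets M W].
  rewrite predeqE => C; split=> [[g _ <-]|[D /lcosetsP[v vW ->] <-]].
    exists (chi g *: M)%g; rewrite ?PhiE //=.
    by apply/lcosetsP; exists (chi g) => //; apply/WE; exists g.
  by move: vW => /WE[g <-]; exists g; rewrite ?PhiE.
apply: card_eq_trans (card_eq_finset _); apply: inj_card_eq => C D.
rewrite !in_setE /= => /lcosetsP[u /WE[g <-] ->] /lcosetsP[v /WE[h <-] ->] Phigh.
have : Phi (chi g *: M)%g g by exact: (lcoset_refl MG).
rewrite Phigh; exact: (@lcoset_eqP _ MG).
Qed.

Section ArtinSchreierProP.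
Variables (p : nat) (K L : fieldType) (f : {rmorphism K -> L}) (S : set L).
Hypotheses (pcharK : p \in [pchar K]) (Kinf : infinite_field K).
Hypotheses (AS_S : forall t, S t -> exists a, t ^+ p - t = f a)
  (S_gen : adjoin f S = [set: L]).

Let pcharL : p \in [pchar L]. Proof. by rewrite (fmorph_pchar f). Qed.
Let p_prime : prime p. Proof. exact: pcharf_prime pcharK. Qed.

Lemma finite_generators (s : seq L) :
  exists2 T : seq L, [set` T] `<=` S & [set` s] `<=` adjoin f [set` T].
Proof.
elim: s => [|x s [T TS sT]]; first by exists [::].
have [T' TS' xT'] := finitely_generated S_gen x.
exists (T' ++ T) => [t /=|y /=]; first by rewrite mem_cat => /orP[/TS'|/TS].
rewrite inE => /orP[/eqP -> {y}|/sT].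
  by apply: adjoinS xT' => t tT /=; rewrite mem_cat tT.
by apply: adjoinS => t tT /=; rewrite mem_cat tT orbT.
Qed.

(** The character is g |-> g t - t; values in the prime field of L are compared
with elements of F_p through natural numbers. *)
Lemma gal_AS_character (t : L) : S t -> exists chi : gal f -> 'F_p,
  (forall g h, chi (g * h)%g = chi g + chi h) /\
  (forall g, chi g = 0 -> g t = t).
Proof.
move=> St; have /choice[n nP] := fun g : gal f => gal_AS pcharK AS_S g St.
have natr_eq (i j : nat) : (i%:R = j%:R :> 'F_p) <-> (i%:R = j%:R :> L).
  wlog ij : i j / (i <= j)%N => [H|].
    have [ij|/ltnW ji] := leqP i j; first exact: H.
    by split=> /esym/(H _ _ ji)/esym.
  have eqE (A : fieldType) : p \in [pchar A] ->
      (i%:R = j%:R :> A) <-> (p %| j - i)%N.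
    move=> pA; rewrite (dvdn_pcharf pA) natrB // subr_eq0.
    by split=> [->|/eqP].
  by rewrite !eqE //; exact: pchar_Fp.
exists (fun g => (n g)%:R); split=> [g h|g].
  rewrite -natrD; apply/natr_eq; apply: (addrI t).
  rewrite -nP galMgE nP -[X in g X]/(t + _).
  by rewrite rmorphD /= gal_nat nP natrD -addrA.
by rewrite -(mulr0n 1) => /natr_eq; rewrite nP => ->; rewrite mulr0n addr0.
Qed.

(** An open subgroup N contains the automorphisms that fix some finite subset T of
the generators, and these form the kernel of the product Chi, with values in
(Z/p)^T, of the characters attached to the elements of T. *)
Lemma gal_AS_pro_p : pro_p_group (gal f) p.
Proof.
split; first exact/gal_profinite/(AS_algebraic pcharK AS_S S_gen).
move=> N N_open [N_group _].
have N1 : N 1%g by have := N_group.1; rewrite unfold_in /= in_setE.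
have /gal_nbhsP[s sN] : nbhs (1%g : gal f) N by exact: open_nbhs_nbhs.
have [T TS sT] := finite_generators s.
have /choice[chi chiP] (i : 'I_(size T)) : exists chi : gal f -> 'F_p,
    (forall g h, chi (g * h)%g = chi g + chi h) /\
    (forall g, chi g = 0 -> g T`_i = T`_i).
  by apply: gal_AS_character; apply: TS; rewrite /= mem_nth.
pose V := 'rV['F_p]_(size T).
pose Chi (g : gal f) : V := \row_i chi i g.
have ChiM : {morph Chi : g h / (g * h)%g}.
  by move=> g h; apply/rowP => i; rewrite !mxE (chiP i).1.
have ChiN g : Chi g = 1%g -> N g.
  move=> /rowP Chi0; apply: sN => x /sT; rewrite gal1gE.
  suff : adjoin f [set` T] `<=` [set x | g x = x] by apply.
  apply: adjoin_min => [|_ [a _ <-]|t /= /(nthP 0)[i iT <-]].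
  - apply/subfieldP; split=> [|y z /= gy gz|y z /= gy gz] /=.
    + exact: rmorph1.
    + by rewrite rmorphB /= gy gz.
    + by rewrite fmorph_div /= gy gz.
  - exact: gal_base.
  - by apply: (chiP (Ordinal iT)).2; have := Chi0 (Ordinal iT); rewrite !mxE.
have [n np cardN] := left_cosets_card ChiM ChiN N_group.
have /(dvdn_pfactor _ _ p_prime)[m _ nE] : (n %| p ^ (1 * size T))%N.
  by move: np; rewrite cardsT card_mx card_Fp.
by exists m; rewrite -nE.
Qed.

Lemma AS_abelian_p_extension : abelian_p_extension f p.
Proof.
split; [|exact: gal_AS_commutative AS_S S_gen|exact: gal_AS_pro_p].
exact: AS_galois pcharK Kinf AS_S S_gen.
Qed.

End ArtinSchreierProP.

(** * Absolute values in characteristic p *)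

Section AbsoluteValues.
Variables (R : realType) (M : fieldType) (v : absolute_value R M).

Lemma absv0 : v 0 = 0.
Proof. exact/(absv_eq0 v 0). Qed.

Lemma absv_gt0 x : (0 < v x) = (x != 0).
Proof.
rewrite lt0r absv_ge0 andbT; congr (~~ _).
by apply/eqP/eqP => /(absv_eq0 v).
Qed.

Lemma absv1 : v 1 = 1.
Proof.
have v1 : v 1 != 0 by rewrite gt_eqF // absv_gt0 oner_eq0.
by apply: (mulfI v1); rewrite -absvM !mulr1.
Qed.

Lemma absvX x n : v (x ^+ n) = v x ^+ n.
Proof. by elim: n => [|n IHn]; rewrite ?absv1 // !exprS absvM IHn. Qed.

Lemma absvV x : v x^-1 = (v x)^-1.
Proof.
have [->|x0] := eqVneq x 0; first by rewrite invr0 absv0 invr0.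
have vx0 : v x != 0 by rewrite gt_eqF // absv_gt0.
by apply: (mulfI vx0); rewrite -absvM !divff // absv1.
Qed.

(** In this form the lemma covers finite fields (n their order), the prime field
(n = p) and -1 (n = 3). *)
Lemma absv_root1 x n : (1 < n)%N -> x ^+ n = x -> x != 0 -> v x = 1.
Proof.
move=> n1 xn x0; have : x ^+ n.-1 = 1.
  by apply: (mulfI x0); rewrite -exprS prednK ?xn ?mulr1 // ltnW.
move=> /(congr1 v); rewrite absvX absv1 => /eqP.
have n0 : (0 < n.-1)%N by rewrite -ltnS prednK // ltnW.
by rewrite pexpr_eq1 ?absv_ge0 // => /eqP.
Qed.

Lemma absvN x : v (- x) = v x.
Proof.
rewrite -mulN1r absvM; suff -> : v (-1) = 1 by rewrite mul1r.
apply: (@absv_root1 _ 3) => //; last by rewrite oppr_eq0 oner_eq0.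
by rewrite -signr_odd expr1.
Qed.

Lemma absvBC x y : v (x - y) = v (y - x).
Proof. by rewrite -absvN opprB. Qed.

Variable p : nat.
Hypothesis pcharM : p \in [pchar M].

(** Since the p^k-th power is additive, (|x + y| / B)^(p^k) <= 2 for all k, where B is
the larger of |x| and |y|; if the quotient were 1 + e with e > 0, the
Bernoulli inequality would make these powers unbounded. *)
Lemma absv_ultra x y : v (x + y) <= Num.max (v x) (v y).
Proof.
set B := Num.max _ _; have B0 : 0 <= B by rewrite le_max absv_ge0.
rewrite leNgt; apply/negP => Bxy.
have [xy0|xy_neq0] := eqVneq (x + y) 0.
  by move: Bxy; rewrite xy0 absv0 ltNge B0.
have v0 : 0 < v (x + y) by rewrite absv_gt0.
have p1 : (1 < p)%N := prime_gt1 (pcharf_prime pcharM).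
have pow k : v (x + y) ^+ (p ^ k) <= B ^+ (p ^ k) *+ 2.
  have -> : v (x + y) ^+ (p ^ k) = v (x ^+ (p ^ k) + y ^+ (p ^ k)).
    rewrite -absvX; congr (v _); elim: k => [|k IHk]; first by rewrite !expr1.
    by rewrite expnSr !exprM IHk (pchar_expD pcharM).
  rewrite mulr2n; apply: le_trans (absvD _ _ _) _.
  by rewrite !absvX; apply: lerD; apply: lerXn2r;
     rewrite ?nnegrE ?absv_ge0 // le_max lexx ?orbT.
have [B_eq0|B_neq0] := eqVneq B 0.
  by have := pow 0; rewrite B_eq0 !expr1 mul0rn leNgt v0.
have {}B0 : 0 < B by rewrite lt0r B_neq0.
pose e := v (x + y) / B - 1.
have e0 : 0 < e by rewrite subr_gt0 ltr_pdivlMr // mul1r.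
have bernoulli n : 1 + e *+ n <= (1 + e) ^+ n.
  elim: n => [|n IHn]; first by rewrite mulr0n addr0.
  have e1 : 0 <= 1 + e by rewrite addr_ge0 // ltW.
  rewrite exprS; apply: le_trans (ler_wpM2l e1 IHn).
  rewrite mulrDr mulr1 mulrDl mul1r mulrS !addrA lerDl.
  by rewrite mulr_ge0 ?mulrn_wge0 // ltW.
have bounded k : e *+ k <= 1.
  have : 1 + e *+ (p ^ k) <= 2.
    apply: le_trans (bernoulli _) _; rewrite /e addrC subrK expr_div_n.
    by rewrite ler_pdivrMr ?exprn_gt0 // mulr_natl pow.
  rewrite -[2]/(1 + 1) lerD2l; apply: le_trans.
  by rewrite ler_pMn2l // ltnW // ltn_expl.
have := bounded (Num.bound e^-1); rewrite leNgt -mulr_natr -ltr_pdivrMl //.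
by rewrite mulr1 archi_boundP // invr_ge0 ltW.
Qed.

Lemma absv_ultra_lt x y B : v x < B -> v y < B -> v (x + y) < B.
Proof. by move=> xB yB; apply: le_lt_trans (absv_ultra _ _) _; rewrite gt_max xB. Qed.

Lemma absv_addl x y : v y < v x -> v (x + y) = v x.
Proof.
move=> yx; apply/eqP; rewrite eq_le; apply/andP; split.
  by apply: le_trans (absv_ultra _ _) _; rewrite ge_max lexx ltW.
rewrite leNgt; apply/negP => xyx.
have := absv_ultra_lt xyx (_ : v (- y) < v x); rewrite absvN addrK => /(_ yx).
by rewrite ltxx.
Qed.

Lemma absv_close x y : v (x - y) < v x -> v y = v x.
Proof.
move=> xyx; have -> : y = x + (y - x) by rewrite addrC subrK.
by apply: absv_addl; rewrite absvBC.
Qed.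

Lemma absv_sum_dominated (I : finType) (F : I -> M) (k : I) :
  (forall i, i != k -> v (F i) < v (F k)) -> v (\sum_i F i) = v (F k).
Proof.
move=> Fk; rewrite (bigD1 k) //=.
have [Fk0|Fk0] := eqVneq (v (F k)) 0.
  rewrite big1 ?addr0 // => i /Fk; rewrite Fk0 => Fi.
  by have := absv_ge0 v (F i); rewrite leNgt Fi.
apply: absv_addl; elim/big_ind: _ => [||i /Fk//].
- by rewrite absv0 lt0r Fk0 absv_ge0.
- by move=> x y; exact: absv_ultra_lt.
Qed.

Lemma av_closure_subfield (A : set M) : subfield A -> subfield (av_closure v A).
Proof.
move=> /subfieldP[A1 AB AV].
have AM x y : A x -> A y -> A (x * y).
  move=> Ax Ay; rewrite -[y]invrK; apply: (AV) => //.
  by rewrite -div1r; apply: AV.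
have clM x y : av_closure v A x -> av_closure v A y -> av_closure v A (x * y).
  move=> clx cly e e0.
  have x1 : 0 < v x + 1 by rewrite ltr_wpDl ?absv_ge0.
  pose d := Num.min 1 (e / (v x + 1)).
  have d0 : 0 < d by rewrite lt_min ltr01 divr_gt0.
  have [z Az yz] := cly d d0.
  have z1 : 0 < v z + 1 by rewrite ltr_wpDl ?absv_ge0.
  have [u Au xu] := clx (e / (v z + 1)) (divr_gt0 e0 z1).
  exists (u * z); first exact: AM.
  have -> : x * y - u * z = x * (y - z) + (x - u) * z.
    by rewrite mulrBr mulrBl addrA subrK.
  apply: absv_ultra_lt; rewrite absvM.
  - have : v x * v (y - z) <= (v x + 1) * v (y - z).
      by rewrite ler_wpM2r ?absv_ge0 // lerDl.
    move=> /le_lt_trans; apply; rewrite -ltr_pdivlMl // mulrC.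
    by apply: lt_le_trans yz _; rewrite ge_min lexx orbT.
  - have : v (x - u) * v z <= v (x - u) * (v z + 1).
      by rewrite ler_wpM2l ?absv_ge0 // lerDl.
    by move=> /le_lt_trans; apply; rewrite -ltr_pdivlMr.
have clV x : av_closure v A x -> av_closure v A x^-1.
  move=> clx e e0; have [->|x0] := eqVneq x 0.
    exists 0; first by rewrite -(subrr 1); exact: AB.
    by rewrite invr0 subrr absv0.
  have vx0 : 0 < v x by rewrite absv_gt0.
  have [|u Au] := clx (Num.min (v x) (e * v x ^+ 2)).
    by rewrite lt_min vx0 mulr_gt0 // exprn_gt0.
  rewrite lt_min => /andP[xux xue]; have vu := absv_close xux.
  have u0 : u != 0 by rewrite -absv_gt0 vu.
  exists u^-1; first by rewrite -div1r; exact: AV.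
  have -> : x^-1 - u^-1 = (u - x) / (x * u).
    by rewrite invfM mulrBl (mulVKf x0) mulrCA divff // mulr1.
  by rewrite absvM absvBC absvV absvM vu -expr2 ltr_pdivrMr ?exprn_gt0.
apply/subfieldP; split.
- by move=> e e0; exists 1 => //; rewrite subrr absv0.
- move=> x y clx cly e e0.
  have [u Au xu] := clx e e0; have [z Az yz] := cly e e0.
  exists (u - z); first exact: AB.
  have -> : x - y - (u - z) = (x - u) + - (y - z) by rewrite !opprD opprK addrACA.
  by apply: absv_ultra_lt; rewrite ?absvN.
- by move=> x y clx cly; apply: clM => //; exact: clV.
Qed.

(** If |y - x| < |y| then |x| = |y|: passing to the closure adds no new values. *)
Lemma av_closure_value (A : set M) y : av_closure v A y -> y != 0 ->
  exists2 x, A x & v x = v y.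
Proof.
rewrite -absv_gt0 => cly y0; have [x Ax /absv_close xy] := cly _ y0.
by exists x.
Qed.

End AbsoluteValues.

Section AbsoluteValueComp.
Variables (R : realType) (K M : fieldType) (h : {rmorphism K -> M}).
Variable v : absolute_value R M.

Lemma absv_comp_eq0 x : v (h x) = 0 <-> x = 0.
Proof.
rewrite (absv_eq0 v (h x)); split=> [/eqP|->]; last exact: rmorph0.
by rewrite fmorph_eq0 => /eqP.
Qed.

Lemma absv_compM x y : v (h (x * y)) = v (h x) * v (h y).
Proof. by rewrite rmorphM absvM. Qed.

Lemma absv_compD x y : v (h (x + y)) <= v (h x) + v (h y).
Proof. by rewrite rmorphD absvD. Qed.

Definition absv_comp : absolute_value R K :=
  AbsoluteValue (fun x => absv_ge0 v (h x)) absv_comp_eq0 absv_compM absv_compD.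

End AbsoluteValueComp.

(** * The places of the rational function field *)

Lemma fraction_quotient (D : idomainType) (x : {fraction D}) :
  exists n d : D, d != 0 /\ x = tofrac n / tofrac d.
Proof.
elim/quotW: x => r; exists (frac r).1, (frac r).2; have d0 := denom_ratioP r.
split=> //; have D0 : tofrac (frac r).2 != 0 by rewrite tofrac_eq0.
apply: (mulIf D0); rewrite divfK //.
apply/eqP; rewrite !piE /equivf /=.
by rewrite !numden_Ratio ?oner_neq0 ?mulr1 // mulrC.
Qed.

Section PlacesOfFunctionField.
Variables (R : realType) (F : finFieldType).
Variable v : absolute_value R {fraction {poly F}}.
Variables (p : nat) (pcharF : p \in [pchar F]).

Lemma pchar_fraction : p \in [pchar {fraction {poly F}}].
Proof. by apply/(rmorph_pchar (@tofrac {poly F}))/(rmorph_pchar (@polyC F)). Qed.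

Let pcharK := pchar_fraction.
Let u (q : {poly F}) := v (tofrac q).

Lemma absv_const (c : F) : c != 0 -> u c%:P = 1.
Proof.
move=> c0; apply: (@absv_root1 _ _ _ _ #|F|).
- exact: finRing_gt1.
- by rewrite -tofracXn -polyC_exp expf_card.
- by rewrite tofrac_eq0 polyC_eq0.
Qed.

Lemma absv_const_le1 (c : F) : u c%:P <= 1.
Proof.
by have [->|/absv_const->//] := eqVneq c 0; rewrite /u rmorph0 absv0.
Qed.

Let uM q r : u (q * r) = u q * u r.
Proof. by rewrite /u rmorphM absvM. Qed.

Let u_ultra q r : u (q + r) <= Num.max (u q) (u r).
Proof. by rewrite /u rmorphD; exact: absv_ultra pcharK _ _. Qed.

Let u_gt0 q : (0 < u q) = (q != 0).
Proof. by rewrite /u absv_gt0 tofrac_eq0. Qed.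

(** If |T| <= 1 then |.| <= 1 on polynomials.  The polynomials with |q| < 1 form a
prime ideal, nonzero since the absolute value is nontrivial; P generates it,
and polynomials prime to P have absolute value 1. *)
Lemma absv_finite_place : nontrivial_av v -> u 'X <= 1 ->
  exists P : {poly F}, [/\ P \is monic, irreducible_poly P, u P < 1
    & forall q, q != 0 -> exists n : nat, u q = u P ^+ n].
Proof.
move=> [x [x0 vx]] uX.
have u_le1 q : u q <= 1.
  elim/poly_ind: q => [|q c IHq]; first by rewrite /u rmorph0 absv0.
  apply: le_trans (u_ultra _ _) _; rewrite ge_max absv_const_le1 andbT uM.
  by rewrite mulr_ile1 // ?absv_ge0.
pose Pr n := `[< exists q : {poly F}, [/\ q != 0, u q < 1 & size q = n] >].
have exPr : exists n, Pr n.
  have [n [d [d0 xE]]] := fraction_quotient x.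
  have n0 : n != 0 by apply: contraNneq x0 => n0; rewrite xE n0 rmorph0 mul0r.
  have [un|un] := boolP (u n < 1); first by exists (size n); apply/asboolP; exists n.
  have [ud|ud] := boolP (u d < 1); first by exists (size d); apply/asboolP; exists d.
  have eq1 q : ~~ (u q < 1) -> u q = 1.
    by rewrite -leNgt => uq; apply/eqP; rewrite eq_le u_le1.
  move: vx; rewrite xE absvM absvV -/(u n) -/(u d) (eq1 _ un) (eq1 _ ud).
  by rewrite divr1 eqxx.
(* P is the monic multiple of a nonzero polynomial Q of least degree with
   absolute value less than 1. *)
case: (ex_minnP exPr) => m /asboolP[Q [Q0 uQ szQ]] mmin.
have {}mmin q : q != 0 -> u q < 1 -> (size Q <= size q)%N.
  by move=> q0 uq; rewrite szQ; apply: mmin; apply/asboolP; exists q.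
pose P := (lead_coef Q)^-1 *: Q.
have lQ0 : (lead_coef Q)^-1 != 0 by rewrite invr_eq0 lead_coef_eq0.
have uP : u P = u Q by rewrite /P -mul_polyC uM absv_const // mul1r.
have szP : size P = size Q by rewrite size_scale.
have P0 : P != 0 by rewrite -u_gt0 uP u_gt0.
have P_monic : P \is monic.
  by rewrite monicE lead_coefZ mulVf // lead_coef_eq0.
have P_irr : irreducible_poly P.
  split.
    rewrite ltnNge; apply/negP => /size1_polyC PE.
    move: uQ; rewrite -uP PE absv_const ?ltxx //.
    by rewrite PE polyC_eq0 in P0.
  move=> r szr1 /dvdpP[s PE].
  have [s0 r0] : s != 0 /\ r != 0 by apply/norP; rewrite -mulf_eq0 -PE.
  have szPE : size P = (size s + size r).-1 by rewrite PE size_mul.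
  have szr : (1 < size r)%N by rewrite ltn_neqAle eq_sym szr1 size_poly_gt0.
  have us : u s = 1.
    apply/eqP; rewrite eq_le u_le1 leNgt; apply/negP => /(mmin _ s0).
    rewrite -szP szPE; move: szr; case: (size r) => [|[|k]] // _.
    by rewrite !addnS /= -ltn_subRL subnn.
  have rP : r %| P by rewrite PE dvdp_mull.
  rewrite -(dvdp_size_eqp rP) eqn_leq (dvdp_leq P0 rP) /= szP.
  have urE : u r = u Q by rewrite -uP PE uM us mul1r.
  by apply: mmin; rewrite ?urE.
exists P; split=> //; first by rewrite uP.
have u_coprime q : ~~ (P %| q) -> u q = 1.
  move=> Pq; have /Bezout_eq1_coprimepP[[a b] /= ab] : coprimep P q.
    rewrite coprimep_def; apply: contraNT Pq => H.
    have /eqp_dvdl <- : gcdp P q %= P by apply: P_irr.2 => //; exact: dvdp_gcdl.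
    exact: dvdp_gcdr.
  apply/eqP; rewrite eq_le u_le1 leNgt; apply/negP => uq.
  have : u 1 < 1.
    rewrite -ab; apply: le_lt_trans (u_ultra _ _) _; rewrite gt_max !uM.
    apply/andP; split.
      by apply: le_lt_trans (_ : u P < 1); rewrite ?uP // ler_piMl // absv_ge0.
    by apply: le_lt_trans uq; rewrite ler_piMl // absv_ge0.
  by rewrite /u rmorph1 absv1 ltxx.
move=> q; have [n] := ubnP (size q); elim: n => // n IHn in q *.
move=> szq q0; have [/dvdpP[r qE]|/u_coprime ->] := boolP (P %| q); last by exists 0.
have r0 : r != 0 by apply: contraNneq q0 => r0; rewrite qE r0 mul0r.
have [|//|k uk] := IHn r.
  rewrite -ltnS (leq_trans _ szq) // qE size_mul // ltnS.
  have := P_irr.1; case: (size P) => [|[|j]] // _.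
  by rewrite !addnS /= ltnS leq_addr.
by exists k.+1; rewrite qE uM uk exprSr.
Qed.

(** The leading term strictly dominates. *)
Lemma absv_infinite_place q : 1 < u 'X -> q != 0 -> u q = u 'X ^+ (size q).-1.
Proof.
move=> uX; elim/poly_ind: q => [|q c IHq]; first by rewrite eqxx.
have [->|q0 _] := eqVneq q 0.
  rewrite mul0r add0r polyC_eq0 size_polyC => c0.
  by rewrite absv_const // c0 expr0.
have uqX : u (q * 'X) = u 'X ^+ size q.
  by rewrite uM IHq // -exprSr prednK // size_poly_gt0.
rewrite size_MXaddC (negPf q0) /= -uqX /u rmorphD; apply: (absv_addl pcharK).
apply: le_lt_trans (absv_const_le1 c) _; rewrite -/(u _) uqX.
by rewrite exprn_egt1 // size_poly_eq0.
Qed.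

Theorem place_uniformizer : nontrivial_av v ->
  exists a, [/\ place_elements F a, 0 < v a, v a < 1
    & forall x, x != 0 -> exists n : int, v x = v a ^ n].
Proof.
move=> v_nontriv.
have frac_case a : 0 < v a -> (forall q, q != 0 -> exists n : int, u q = v a ^ n) ->
    forall x, x != 0 -> exists n : int, v x = v a ^ n.
  move=> va uq x; have [n [d [d0 ->]]] := fraction_quotient x => x0.
  have n0 : n != 0 by apply: contraNneq x0 => ->; rewrite rmorph0 mul0r.
  have [i un] := uq _ n0; have [j ud] := uq _ d0.
  exists (i - j); rewrite absvM absvV -/(u n) -/(u d) un ud.
  by rewrite expfzDr ?gt_eqF // -invr_expz.
have [uX|uX] := leP (u 'X) 1.
  have [P [P_monic P_irr uP uE]] := absv_finite_place v_nontriv uX.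
  exists (tofrac P); rewrite -/(u P).
  have uP0 : 0 < u P by rewrite u_gt0 irredp_neq0.
  split=> //; first by left; exists P.
  by apply: frac_case => // q /uE[n ->]; exists n.
have vX : v (tofrac 'X)^-1 = (u 'X)^-1 by rewrite absvV.
have uX0 : 0 < u 'X by rewrite (lt_trans ltr01).
exists (tofrac 'X)^-1; split; first by right.
- by rewrite vX invr_gt0.
- by rewrite vX invf_lt1.
- apply: frac_case => [|q q0]; first by rewrite vX invr_gt0.
  exists (- ((size q).-1%:Z)); rewrite (absv_infinite_place uX q0) vX.
  by rewrite exprz_inv opprK.
Qed.

End PlacesOfFunctionField.

(** * Linear independence of Artin-Schreier roots over a discretely valued field *)

Section LocalIndependence.
Variables (R : realType) (E M : fieldType) (h : {rmorphism E -> M}).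
Variables (v : absolute_value R M) (b : E) (theta : nat -> M).
Variables (p : nat) (pcharM : p \in [pchar M]).
Hypotheses (vb0 : 0 < v (h b)) (vb1 : v (h b) < 1).
Hypothesis v_discrete : forall x, x != 0 -> exists n : int, v (h x) = v (h b) ^ n.
Hypothesis AS_theta : forall i, ~~ (p %| i)%N ->
  theta i ^+ p - theta i = h (b ^- i).

Let p_gt1 : (1 < p)%N. Proof. exact: prime_gt1 (pcharf_prime pcharM). Qed.

(** Induction on the number of nonzero coefficients.  If c k1 is not 0, dividing by
it gives a relation with coefficients d, where d k1 = 1; its p-th power minus
itself has the coefficients d^p - d, which vanish wherever d does and also at k1.
So d^p = d, and the absolute values contradict p not dividing the indices. *)
Lemma AS_theta_independent (m : nat) (idx : 'I_m -> nat) :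
  injective idx -> (forall k, ~~ (p %| idx k)%N) ->
  forall (c : 'I_m -> E) (c0 : E),
  \sum_k h (c k) * theta (idx k) = h c0 -> forall k, c k = 0.
Proof.
move=> idx_inj idx_p c c0.
have [n] := ubnP #|[pred k | c k != 0]|; elim: n => // n IHn in c c0 *.
move=> cn rel k1; apply/eqP; apply: contraT => ck1.
pose d k := c k / c k1; pose d0 := c0 / c k1.
have d_rel : \sum_k h (d k) * theta (idx k) = h d0.
  rewrite /d0 fmorph_div -rel mulr_suml; apply: eq_bigr => k _.
  by rewrite fmorph_div mulrAC.
have d_fix k : d k ^+ p = d k.
  (* The constant term of the p-th power of the relation minus the relation. *)
  pose e0 := d0 ^+ p - d0 - \sum_k d k ^+ p * b ^- idx k.
  apply/eqP; rewrite -subr_eq0; apply/eqP.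
  apply: (IHn (fun k => d k ^+ p - d k) e0); last first.
    rewrite (eq_bigr (fun k => (h (d k) * theta (idx k)) ^+ p
      - h (d k) * theta (idx k) - h (d k ^+ p * b ^- idx k))).
      rewrite !sumrB d_rel /e0 !rmorphB rmorphXn rmorph_sum /=; congr (_ - _ - _).
      have frobE x : x ^+ p = pFrobenius_aut pcharM x by [].
      by rewrite [RHS]frobE -d_rel rmorph_sum.
    move=> i _; move: (d i) (theta (idx i)) (AS_theta (idx_p i)) => x t tE.
    rewrite exprMn [h (x ^+ p * _)]rmorphM -tE rmorphB !rmorphXn /= mulrBl mulrBr.
    by rewrite opprB [RHS]addrC addrA subrK.
  rewrite -ltnS (leq_trans _ cn) // ltnS; apply: proper_card.
  apply/properP; split.
    apply/fintype.subsetP => i; rewrite !inE; apply: contraNN => /eqP ci0.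
    by rewrite /d ci0 mul0r expr0n gtn_eqF ?subrr // ltnW.
  by exists k1; rewrite !inE // /d divff // expr1n subrr eqxx.
have vd k : d k != 0 -> v (h (d k)) = 1.
  move=> dk; apply: (absv_root1 v p_gt1); last by rewrite fmorph_eq0.
  by rewrite -rmorphXn d_fix.
(* The dominant term of sum d_k b^-(idx k) is the one with the largest index. *)
pose top := [arg max_(k > k1 | (d k != 0)%R) idx k]%N.
have [dtop top_max] : d top != 0 /\ forall k, d k != 0 -> (idx k <= idx top)%N.
  have dk1 : d k1 != 0 by rewrite /d divff ?oner_neq0.
  by rewrite /top; case: arg_maxnP.
have vterm k : d k != 0 -> v (h (d k * b ^- idx k)) = v (h b) ^- idx k.
  by move=> dk; rewrite rmorphM absvM vd // mul1r fmorphV rmorphXn absvV absvX.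
have relb : \sum_k h (d k * b ^- idx k) = h (d0 ^+ p - d0).
  apply/eqP; rewrite rmorphB rmorphXn -d_rel.
  have frobE x : x ^+ p = pFrobenius_aut pcharM x by [].
  rewrite frobE rmorph_sum -sumrB; apply/eqP; apply: eq_bigr => k _.
  rewrite /= -frobE exprMn -rmorphXn d_fix -mulrBr AS_theta //.
  by rewrite rmorphM.
have idx_gt0 k : (0 < idx k)%N.
  by rewrite lt0n; apply: contraNneq (idx_p k) => ->; rewrite dvdn0.
have vsum : v (h (d0 ^+ p - d0)) = v (h b) ^- idx top.
  rewrite -relb -(vterm _ dtop); apply: (absv_sum_dominated pcharM) => k ktop.
  rewrite (vterm _ dtop); have [->|dk] := eqVneq (d k) 0.
    by rewrite mul0r rmorph0 absv0 invr_gt0 exprn_gt0.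
  rewrite (vterm _ dk) ltf_pV2 ?posrE ?exprn_gt0 // ltr_iXn2l //.
  by rewrite ltn_neqAle top_max // andbT; apply: contraNneq ktop => /idx_inj ->.
(* Hence |d0| > 1, and |d0^p - d0| = |d0|^p. *)
have vsum_gt1 : 1 < v (h (d0 ^+ p - d0)).
  by rewrite vsum invf_gt1 ?exprn_gt0 // exprn_ilt1 // -?lt0n // ltW.
have d00 : d0 != 0.
  apply: contraTneq vsum_gt1 => ->.
  by rewrite expr0n gtn_eqF ?subrr ?rmorph0 ?absv0 ?ltr10 // ltnW.
have vd0 : 1 < v (h d0).
  rewrite ltNge; apply: (contraTN _ vsum_gt1) => vd0; rewrite -leNgt rmorphB.
  apply: (le_trans (absv_ultra v pcharM (h (d0 ^+ p)) (- h d0))).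
  rewrite absvN ge_max vd0 andbT.
  by rewrite rmorphXn absvX exprn_ile1 // absv_ge0.
have [z vd0E] := v_discrete d00.
have : v (h b) ^ (- (idx top)%:Z) = v (h b) ^ (z * p%:Z).
  rewrite -exprnN -[LHS]vsum -exprz_exp -vd0E rmorphB rmorphXn /=.
  rewrite (absv_addl pcharM) ?absvX // absvN.
  by rewrite -[X in X < _]expr1 ltr_eXn2l.
have vb_neq1 : v (h b) != 1 by rewrite lt_eqF.
move=> /(ieexprIz vb0 vb_neq1) idxE.
have : (p%:Z %| - (idx top)%:Z)%Z by rewrite idxE dvdz_mull.
by rewrite dvdzE abszN (negPf (idx_p top)).
Qed.

End LocalIndependence.

(** * Infinite local degrees *)

(** Express n + 1 of the vectors t on n generators: the matrix of coefficients has
more rows than columns, hence a nonzero row in its left kernel, which is a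
linear relation. *)
Lemma not_finite_over (E M : fieldType) (h : {rmorphism E -> M}) (B : set M)
    (t : nat -> M) :
  (forall n, B (t n)) ->
  (forall n (c : 'I_n -> E), \sum_k h (c k) * t k = 0 -> forall k, c k = 0) ->
  ~ finite_over (range h) B.
Proof.
move=> Bt t_indep [n [e [_ e_gen]]].
have /choice[C CE] (i : 'I_n.+1) : exists c : 'I_n -> E,
    t i = \sum_j h (c j) * e j.
  have [c /choice[c' c'E] ->] : exists2 c : 'I_n -> M,
      forall j, exists x, h x = c j & t i = \sum_j c j * e j.
    by have [c cR tE] := e_gen _ (Bt i); exists c => // j; have [x _ <-] := cR j; exists x.
  by exists c'; apply: eq_bigr => j _; rewrite c'E.
pose A : 'M_(n.+1, n) := \matrix_(i, j) C i j.
have : kermx A != 0.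
  rewrite kermx_eq0 /row_free neq_ltn (leq_ltn_trans (rank_leq_col A)) //.
move=> /rowV0Pn[r /sub_kermxP rA]; apply/negP; rewrite negbK.
apply/eqP/rowP => i; rewrite mxE.
apply: (t_indep _ (fun k => r 0 k)).
rewrite (eq_bigr (fun k => \sum_j h (r 0 k * C k j) * e j)); last first.
  by move=> k _; rewrite CE mulr_sumr; apply: eq_bigr => j _; rewrite rmorphM mulrA.
rewrite exchange_big big1 //= => j _.
rewrite -mulr_suml -rmorph_sum.
have -> : \sum_k r 0 k * C k j = (r *m A) 0 j by rewrite mxE; apply: eq_bigr => k _; rewrite mxE.
by rewrite rA mxE rmorph0 mul0r.
Qed.

Section LocalDegrees.
Variables (R : realType) (F : finFieldType) (p : nat).
Variables (L : fieldType) (f : {rmorphism {fraction {poly F}} -> L}).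
Variable theta : {fraction {poly F}} * nat -> L.
Hypotheses (pcharF : p \in [pchar F]) (f_alg : algebraic_ext f).
Hypothesis AS_theta : forall a i, index_set F p (a, i) ->
  theta (a, i) ^+ p - theta (a, i) = f (a ^- i).

(** The absolute value u is the restriction to K of the one on the completion M;
it is equivalent to v and a is the element of the corresponding place.  The
indices n p + 1 are prime to p. *)
Lemma AS_local_degrees_infinite : local_degrees_infinite R f.
Proof.
move=> v w [x0 [x0_neq0 vx0]] _ [s s0 wv] M.
pose e : {rmorphism L -> M} := cpl_emb M.
pose g : {rmorphism {fraction {poly F}} -> M} := e \o f.
pose u := absv_comp g (cpl_av M).
have uE x : u x = v x `^ s by rewrite /u /= cpl_isometry wv.
have u_nontriv : nontrivial_av u.
  exists x0; split=> //; apply: contraNneq vx0; rewrite uE => vs.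
  have -> : v x0 = v x0 `^ (s / s).
    by rewrite divff ?lt0r_neq0 // powRr1 // absv_ge0.
  by rewrite powRrM vs powR1.
have [a [a_place ua0 ua1 u_discrete]] := place_uniformizer pcharF u_nontriv.
have pcharM : p \in [pchar M] by rewrite (fmorph_pchar g) pchar_fraction.
pose A := local_completion M (range f).
have A_sub : subfield A.
  by apply: av_closure_subfield pcharM _ _; do 2?apply: subfield_image; exact: subfield_setT.
have gA x : A (g x).
  by move=> r r0; exists (g x); rewrite ?subrr ?absv0 //; exists (f x) => //; exists x.
(* The closure A of K, as a field type E. *)
pose E := adjoin_field g A.
pose h : {rmorphism E -> M} := \val.
have hA : range h = A.
  rewrite predeqE => y; split=> [[x _ <-]|Ay].
    have : adjoin g A `<=` A by apply: adjoin_min => // _ [z _ <-].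
    apply; have := adjoin_valP x; by rewrite unfold_in /= in_setE.
  have yP : y \in adjoin_pred g A by apply: mem_set; exact: sub_adjoin.
  by exists (AdjoinField yP).
pose idx n := (n * p).+1.
have p_prime := pcharf_prime pcharF.
have idx_p n : ~~ (p %| idx n)%N.
  by rewrite /idx -addn1 dvdn_addr ?dvdn_mull // gtnNdvd // prime_gt1.
have idx_inj : injective idx.
  by move=> m n /eqP; rewrite eqSS eqn_pmul2r ?prime_gt0 // => /eqP.
pose t n := e (theta (a, idx n)).
rewrite -[X in finite_over X]hA; apply: (not_finite_over (t := t)) => [n|n c].
  exists (poly_values f (theta (a, idx n))).
    exact: finite_subextension_poly_values.
  move=> r r0; exists (t n); last by rewrite subrr absv0.
  by exists (theta (a, idx n)) => //; exact: poly_values_id.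
rewrite -(rmorph0 h); pose b : E := adjoin_emb g A a.
apply: (@AS_theta_independent _ _ _ h (cpl_av M) b (fun i => e (theta (a, i)))
  p pcharM ua0 ua1 _ _ n (fun k => idx k)) => //.
- move=> x x_neq0; have hx : A (h x).
    have : range h (h x) by exists x.
    by rewrite hA.
  have [|_ [_ [y _ <-] <-] vy] := av_closure_value pcharM hx; first by rewrite fmorph_eq0.
  have y0 : y != 0.
    apply: contraNneq x_neq0 => y0; rewrite -(fmorph_eq0 h).
    by apply/eqP/(absv_eq0 (cpl_av M)); rewrite -vy y0 !rmorph0 absv0.
  have [m um] := u_discrete _ y0; exists m; rewrite -vy; exact: um.
- move=> i ip; rewrite -rmorphXn -rmorphB AS_theta; last by split.
  by rewrite -[LHS]/(g (a ^- i)) !fmorphV !rmorphXn.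
- by move=> k l /idx_inj/val_inj.
Qed.

End LocalDegrees.

Lemma infinite_fraction (F : fieldType) : infinite_field {fraction {poly F}}.
Proof.
move=> n; exists [seq tofrac ('X^i : {poly F}) | i <- iota 0 n].
rewrite size_map size_iota map_inj_uniq ?iota_uniq // => i j.
move=> /eqP; rewrite tofrac_eq => /eqP /(congr1 (fun q : {poly F} => size q)).
by rewrite !size_polyXn => -[].
Qed.

(** Generators of a compositum inside E still generate it as an abstract field. *)
Lemma adjoin_emb_gen (K E : fieldType) (f : {rmorphism K -> E}) (I : Type)
    (D : set I) (t : I -> E) (S := \bigcup_(i in D) adjoin f [set t i]) :
  adjoin (adjoin_emb f S) [set x | exists2 i, D i & val x = t i] = [set: adjoin_field f S].
Proof.
set T := [set x | _]; rewrite predeqE => x; split=> // _.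
pose h : {rmorphism adjoin_field f S -> E} := \val.
have sub : adjoin f S `<=` h @` adjoin (adjoin_emb f S) T.
  have him : subfield (h @` adjoin (adjoin_emb f S) T).
    by apply: subfield_image; exact: adjoinP.
  have base : range f `<=` h @` adjoin (adjoin_emb f S) T.
    by move=> _ [y _ <-]; exists (adjoin_emb f S y) => //; exact: range_adjoin.
  apply: adjoin_min => // y [i Di]; move: y; apply: adjoin_min => // _ ->.
  have tP : t i \in adjoin_pred f S.
    by apply: mem_set; apply: sub_adjoin; exists i => //; exact: sub_adjoin.
  by exists (AdjoinField tP) => //; apply: sub_adjoin; exists i.
have [|y Ty /val_inj <- //] := sub (val x).
by have := adjoin_valP x; rewrite unfold_in /= in_setE.
Qed.

Theorem mainTheorem2 (R : realType) (F : finFieldType) (p : nat)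
    (charFp : p \in [pchar F])
    (kbar : closedFieldType) (iota : {rmorphism {fraction {poly F}} -> kbar})
    (kbar_algebraic : algebraic_ext iota)
    (theta : {fraction {poly F}} * nat -> kbar)
    (theta_root : forall a i, index_set F p (a, i) ->
      root (map_poly iota ('X^p - 'X - (a ^- i)%:P)) (theta (a, i))) :
  let L_embedding :=
    adjoin_emb iota (\bigcup_(ai in index_set F p) adjoin iota [set theta ai])
  in
  abelian_p_extension L_embedding p /\ local_degrees_infinite R L_embedding.
Proof.
move=> f.
pose L := adjoin_field iota (\bigcup_(ai in index_set F p) adjoin iota [set theta ai]).
have pcharK := pchar_fraction charFp.
have gen := adjoin_emb_gen iota (index_set F p) theta; rewrite -/f -/L in gen.
pose theta' ai : L := insubd 0 (theta ai).
have theta'E ai : index_set F p ai -> val (theta' ai) = theta ai.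
  move=> aiP; rewrite val_insubd ifT //; apply: mem_set; apply: sub_adjoin.
  by exists ai => //; exact: sub_adjoin.
have AS_theta a i (x : L) : index_set F p (a, i) -> val x = theta (a, i) ->
    x ^+ p - x = f (a ^- i).
  move=> aiP xE; apply: val_inj; rewrite rmorphB rmorphXn /= xE.
  by apply/(root_ASpoly p iota); exact: theta_root.
have AS_S (t : L) : (exists2 ai, index_set F p ai & val t = theta ai) ->
    exists a, t ^+ p - t = f a.
  by move=> [[a i] aiP tE]; exists (a ^- i); exact: AS_theta.
split.
  exact: (AS_abelian_p_extension pcharK (@infinite_fraction F) AS_S gen).
apply: (AS_local_degrees_infinite (theta := theta') charFp).
  exact: (AS_algebraic pcharK AS_S gen).
by move=> a i aiP; apply: AS_theta => //; exact: theta'E.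
Qed.
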